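(* Let $k\ge 2$ be an integer. For every $\lambda>0$, with the possible exception of one value, and for every $\epsilon>0$, the function $u(z)$ obtained by analytic continuation of $$u(x)=e^{-\frac{x^2}{2}}\Big[\lambda+\sqrt{2k-2}\,\mathrm{Erfc}\Big(\sqrt{\tfrac{k-1}{2}}\,x\Big)\Big]^{\frac{1}{1-k}},\qquad x\in\mathbb{R},$$ has a sequence of singularities which tends to infinity in the sector $\pi/4<\arg z<\pi/4+\epsilon$ or in the sector $3\pi/4-\epsilon<\arg z<3\pi/4$.
   Context: The complementary error function is normalized as $\mathrm{Erfc}(t)=\int_t^{+\infty}e^{-v^2}\,dv$, and $\mathrm{Erfc}(z)$ also denotes its entire extension to $\mathbb{C}$. Roots are positive for positive numbers, with continuous extension to the complex domain (principal branches). For $\lambda>0$ the function $u$ is well defined and analytic on $\mathbb{R}$; it is the solution of $$u''-x^2u+u=\Big(\frac{d}{dx}-x\Big)u^k,\qquad u(0)=u_0>0,$$ with $\lambda=u_0^{1-k}-\sqrt{\frac{\pi(k-1)}{2}}$ (so $\lambda>0$ means $0<u_0<(\pi(k-1)/2)^{1/(2-2k)}$). The singularities of $u(z)$ referred to are the points $z_0\in\mathbb{C}$ at which $\lambda+\sqrt{2k-2}\,\mathrm{Erfc}\big(\sqrt{\tfrac{k-1}{2}}\,z_0\big)=0$. *)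

(* Defs.v *)
From Stdlib Require Import Reals Lra Lia Psatz.
From Coquelicot Require Import Coquelicot.
Open Scope R_scope.

Definition Cexp (z : C) : C :=
  (exp (Re z) * cos (Im z), exp (Re z) * sin (Im z)).

(* Unnormalized: Erfc_R 0 = sqrt PI / 2. *)
Definition Erfc_R (t : R) : R :=
  RInt_gen (fun v => exp (- v ^ 2)) (at_point t) (Rbar_locally p_infty).

(* The integral of exp(-v^2) over [0, z] is taken along the straight segment
   v = t z.  [Erfc_RtoC] and [Erfc_entire] show that this is the
   entire extension of [Erfc_R]. *)
Definition Erfc (z : C) : C :=
  (RtoC (Erfc_R 0) -
   z * RInt (V := C_R_CompleteNormedModule)
         (fun t : R => Cexp (- (RtoC t * z) ^ 2)) 0 1)%C.

Definition u_bracket (k : nat) (lam : R) (z : C) : C :=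
  (RtoC lam +
   RtoC (sqrt (2 * INR k - 2)) * Erfc (RtoC (sqrt ((INR k - 1) / 2)) * z))%C.

(* The power has real exponent and, for lam > 0, positive real base. *)
Definition u (k : nat) (lam x : R) : R :=
  exp (- x ^ 2 / 2) *
  Rpower (lam + sqrt (2 * INR k - 2) * Erfc_R (sqrt ((INR k - 1) / 2) * x))
         (1 / (1 - INR k)).

(* Singularities of the (for k > 2 multivalued) analytic continuation of u.
   Every continuation w of u satisfies
   w(z)^(k-1) * u_bracket k lam z = exp(-(k-1) z^2 / 2), hence is unbounded at
   the zeros of the bracket (poles for k = 2, algebraic branch points for
   k > 2), and it continues along all paths avoiding them. *)
Definition u_singularity (k : nat) (lam : R) (z0 : C) : Prop :=
  u_bracket k lam z0 = 0%C.

(* theta is the principal argument of z. *)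
Definition is_arg (z : C) (theta : R) : Prop :=
  z <> 0%C /\ - PI < theta <= PI /\
  z = (Cmod z * cos theta, Cmod z * sin theta).

Definition sector (alpha beta : R) (z : C) : Prop :=
  exists theta : R, is_arg z theta /\ alpha < theta < beta.

Definition tends_to_infinity (z : nat -> C) : Prop :=
  is_lim_seq (fun n => Cmod (z n)) p_infty.

Lemma gauss_ex_RInt a b : ex_RInt (fun v => exp (- v ^ 2)) a b.
Proof.
apply (ex_RInt_continuous (V := R_CompleteNormedModule)); intros x _.
apply (ex_derive_continuous (K := R_AbsRing) (V := R_NormedModule)).
auto_derive; trivial.
Qed.

Lemma gauss_RInt_bound t : 0 <= t -> RInt (fun v => exp (- v ^ 2)) 0 t <= exp 1.
Proof.
intros Ht.
apply Rle_trans with (RInt (fun v => exp (1 - v)) 0 t).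
{ apply RInt_le; trivial; [apply gauss_ex_RInt | |].
  - apply (ex_RInt_continuous (V := R_CompleteNormedModule)); intros x _.
    apply (ex_derive_continuous (K := R_AbsRing) (V := R_NormedModule)).
    auto_derive; trivial.
  - intros x _.
    destruct (Rle_lt_or_eq_dec (- x ^ 2) (1 - x)) as [H|H]; [nra| |].
    + left; apply exp_increasing; exact H.
    + rewrite H; lra. }
assert (H : is_RInt (fun v => exp (1 - v)) 0 t (- exp (1 - t) - - exp (1 - 0))).
{ apply (is_RInt_derive (V := R_CompleteNormedModule) (fun v => - exp (1 - v))).
  - intros x _; auto_derive; trivial; unfold Rminus; ring.
  - intros x _.
    apply (ex_derive_continuous (K := R_AbsRing) (V := R_NormedModule)).
    auto_derive; trivial. }
rewrite (is_RInt_unique _ _ _ _ H), Rminus_0_r.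
pose proof (exp_pos (1 - t)); lra.
Qed.

Lemma gauss_ex_RInt_gen t :
  ex_RInt_gen (fun v => exp (- v ^ 2)) (at_point t) (Rbar_locally p_infty).
Proof.
set (f := fun v => exp (- v ^ 2)).
set (F := fun x => RInt f 0 x).
assert (Fm : forall x y, x <= y -> F x <= F y).
{ intros x y Hxy; unfold F.
  rewrite <- (RInt_Chasles f 0 x y) by apply gauss_ex_RInt.
  assert (0 <= RInt f x y)
    by (apply RInt_ge_0; trivial; [apply gauss_ex_RInt | intros; left; apply exp_pos]).
  unfold plus; simpl; lra. }
destruct (completeness (fun y => exists x, 0 <= x /\ y = F x)) as [S [HS1 HS2]].
{ exists (exp 1); intros y [x [Hx ->]]; apply gauss_RInt_bound; exact Hx. }
{ exists (F 0), 0; split; [lra | reflexivity]. }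
apply (ex_RInt_gen_Chasles (V := R_NormedModule) f 0).
{ exists (RInt f t 0).
  apply is_RInt_gen_at_point, (RInt_correct (V := R_CompleteNormedModule)), gauss_ex_RInt. }
exists S; intros P [eps HP].
assert (HX : exists X, 0 <= X /\ S - eps < F X).
{ destruct (Classical_Prop.classic (exists X, 0 <= X /\ S - eps < F X)) as [H|H]; trivial.
  exfalso. assert (S <= S - eps).
  { apply HS2; intros y [x [Hx ->]].
    destruct (Rle_or_lt (F x) (S - eps)); trivial.
    exfalso; apply H; exists x; auto. }
  destruct eps as [e he]; simpl in *; lra. }
destruct HX as [X [HX0 HX]].
exists (fun x => x = 0) (fun y => X < y); [reflexivity | exists X; trivial |].
intros x y -> Hy; exists (F y); simpl; split.
{ apply (RInt_correct (V := R_CompleteNormedModule)), gauss_ex_RInt. }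
apply HP; unfold ball; simpl; unfold AbsRing_ball, abs, minus, plus, opp; simpl.
assert (F X <= F y) by (apply Fm; lra).
assert (F y <= S) by (apply HS1; exists y; split; [lra | reflexivity]).
destruct eps as [e he]; simpl in *; apply Rabs_def1; lra.
Qed.

Lemma Erfc_R_correct t :
  is_RInt_gen (fun v => exp (- v ^ 2)) (at_point t) (Rbar_locally p_infty) (Erfc_R t).
Proof. apply (RInt_gen_correct (V := R_CompleteNormedModule)), gauss_ex_RInt_gen. Qed.

Definition gauss (z : C) : C := Cexp (- z ^ 2)%C.

Lemma gauss_seg (x y t : R) :
  gauss (RtoC t * (x, y))%C =
  (exp (t * t * (y * y - x * x)) * cos (- 2 * (t * t) * x * y),
   exp (t * t * (y * y - x * x)) * sin (- 2 * (t * t) * x * y)).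
Proof.
unfold gauss, Cexp; simpl.
f_equal; (f_equal; [f_equal; ring | f_equal; ring]).
Qed.

Lemma gauss_seg_is_RInt z :
  is_RInt (V := C_R_NormedModule) (fun t : R => gauss (RtoC t * z)%C) 0 1
    (RInt (V := C_R_CompleteNormedModule) (fun t : R => gauss (RtoC t * z)%C) 0 1).
Proof.
apply (RInt_correct (V := C_R_CompleteNormedModule)).
destruct z as [x y].
apply (ex_RInt_ext (V := C_R_NormedModule)) with (f := fun t : R =>
  (exp (t * t * (y * y - x * x)) * cos (- 2 * (t * t) * x * y),
   exp (t * t * (y * y - x * x)) * sin (- 2 * (t * t) * x * y))).
{ intros t _; symmetry; apply gauss_seg. }
eexists.
apply (is_RInt_fct_extend_pair (U := R_NormedModule) (V := R_NormedModule)); simpl;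
  apply (RInt_correct (V := R_CompleteNormedModule));
  apply (ex_RInt_continuous (V := R_CompleteNormedModule)); intros t _;
  apply (ex_derive_continuous (K := R_AbsRing) (V := R_NormedModule));
  auto_derive; trivial.
Qed.

Lemma is_RInt_Cmult (c : C) (g : R -> C) (a b : R) (l : C) :
  is_RInt (V := C_R_NormedModule) g a b l ->
  is_RInt (V := C_R_NormedModule) (fun t => c * g t)%C a b (c * l)%C.
Proof.
intros H.
pose proof (is_RInt_fct_extend_fst (U := R_NormedModule) (V := R_NormedModule) g a b l H) as H1.
pose proof (is_RInt_fct_extend_snd (U := R_NormedModule) (V := R_NormedModule) g a b l H) as H2.
destruct c as [c d], l as [l m]; simpl in H1, H2.
apply (is_RInt_fct_extend_pair (U := R_NormedModule) (V := R_NormedModule)); simpl.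
- apply (is_RInt_minus (V := R_NormedModule));
    apply (is_RInt_scal (V := R_NormedModule)); assumption.
- apply (is_RInt_plus (V := R_NormedModule));
    apply (is_RInt_scal (V := R_NormedModule)); assumption.
Qed.

Lemma Erfc_RtoC (t : R) : Erfc (RtoC t) = RtoC (Erfc_R t).
Proof.
unfold Erfc.
assert (E : Erfc_R t = Erfc_R 0 - RInt (fun v => exp (- v ^ 2)) 0 t).
{ assert (H : is_RInt_gen (fun v => exp (- v ^ 2)) (at_point 0)
       (Rbar_locally p_infty) (plus (RInt (fun v => exp (- v ^ 2)) 0 t) (Erfc_R t))).
  { apply (is_RInt_gen_Chasles (V := R_NormedModule)) with (b := t).
    - apply is_RInt_gen_at_point, (RInt_correct (V := R_CompleteNormedModule)), gauss_ex_RInt.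
    - apply Erfc_R_correct. }
  apply (is_RInt_gen_unique (V := R_CompleteNormedModule)) in H.
  unfold Erfc_R at 2; rewrite H; unfold plus; simpl; ring. }
rewrite E, RtoC_minus; f_equal; f_equal.
symmetry.
pose proof (RInt_correct (V := R_CompleteNormedModule) _ _ _ (gauss_ex_RInt 0 t)) as H.
replace 0 with (t * 0 + 0) in H at 1 by ring.
replace t with (t * 1 + 0) in H at 2 by ring.
apply (is_RInt_comp_lin (V := R_NormedModule)) in H.
pose proof (is_RInt_Cmult (RtoC t) _ 0 1 _ (gauss_seg_is_RInt (RtoC t))) as G.
unfold gauss in G.
match type of G with is_RInt _ _ _ ?l => set (L := l) in * end.
assert (G' : is_RInt (V := C_R_NormedModule)
  (fun s : R => (RtoC t * Cexp (- (RtoC s * RtoC t) ^ 2))%C) 0 1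
  (RtoC (RInt (fun v => exp (- v ^ 2)) 0 t))).
{ apply (is_RInt_fct_extend_pair (U := R_NormedModule) (V := R_NormedModule)).
  - eapply is_RInt_ext; [| exact H].
    intros s _; unfold scal; simpl; unfold mult; simpl.
    replace (- (((s * t - 0 * 0) * ((s * t - 0 * 0) * 1 - (s * 0 + 0 * t) * 0) -
      (s * 0 + 0 * t) * ((s * t - 0 * 0) * 0 + (s * 0 + 0 * t) * 1))))
      with (- ((t * s + 0) * ((t * s + 0) * 1))) by ring.
    replace (- ((s * t - 0 * 0) * ((s * t - 0 * 0) * 0 + (s * 0 + 0 * t) * 1) +
      (s * 0 + 0 * t) * ((s * t - 0 * 0) * 1 - (s * 0 + 0 * t) * 0))) with 0 by ring.
    rewrite cos_0, sin_0; ring.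
  - apply (is_RInt_ext (V := R_NormedModule)) with (f := fun _ => 0).
    + intros s _; simpl.
      replace (- ((s * t - 0 * 0) * ((s * t - 0 * 0) * 0 + (s * 0 + 0 * t) * 1) +
        (s * 0 + 0 * t) * ((s * t - 0 * 0) * 1 - (s * 0 + 0 * t) * 0))) with 0 by ring.
      rewrite sin_0; ring.
    + pose proof (is_RInt_const (V := R_NormedModule) 0 1 0) as K.
      unfold scal in K; simpl in K; unfold mult in K; simpl in K.
      rewrite Rmult_0_r in K.
      exact K. }
apply (is_RInt_unique (V := C_R_CompleteNormedModule)) in G.
apply (is_RInt_unique (V := C_R_CompleteNormedModule)) in G'.
rewrite <- G'; exact G.
Qed.

Lemma Cmod_le_components (z : C) (b : R) :
  Rabs (fst z) <= b -> Rabs (snd z) <= b -> Cmod z <= 2 * b.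
Proof.
intros H1 H2.
apply Rle_trans with (1 := Cmod_2Rmax z).
assert (0 <= b) by (pose proof (Rabs_pos (fst z)); lra).
apply Rmult_le_compat; [apply sqrt_pos | | | apply Rmax_lub; assumption].
- apply Rle_trans with (1 := Rabs_pos (fst z)), Rmax_l.
- rewrite <- (sqrt_square 2) at 2 by lra. apply sqrt_le_1; lra.
Qed.

Lemma Cexp_plus (a b : C) : Cexp (a + b)%C = (Cexp a * Cexp b)%C.
Proof.
destruct a as [x y], b as [x' y']; unfold Cexp; simpl.
rewrite exp_plus, cos_plus, sin_plus.
unfold Cmult; simpl; f_equal; ring.
Qed.

Lemma Cmod_Cexp (a : C) : Cmod (Cexp a) = exp (Re a).
Proof.
unfold Cexp, Cmod; simpl.
replace (_ + _) with (exp (Re a) * exp (Re a) * ((sin (Im a))² + (cos (Im a))²))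
  by (unfold Rsqr; ring).
rewrite sin2_cos2, Rmult_1_r; apply sqrt_square; left; apply exp_pos.
Qed.

Lemma exp_sub1_bound x : Rabs x <= 1 -> Rabs (exp x - 1) <= 3 * Rabs x.
Proof.
intros Hx.
destruct (MVT_cor4 exp exp 0 1) with (b := x) as [c [H1 H2]].
{ intros c _; auto_derive; trivial; ring. }
{ rewrite Rminus_0_r; exact Hx. }
rewrite exp_0, Rminus_0_r in H1; rewrite H1, Rabs_mult.
rewrite !Rminus_0_r in H2.
apply Rmult_le_compat_r; [apply Rabs_pos |].
rewrite Rabs_pos_eq by (left; apply exp_pos).
apply Rle_trans with (exp 1); [| apply exp_le_3].
assert (c <= 1) by (pose proof (Rle_abs c); lra).
destruct (Rle_lt_or_eq_dec c 1) as [h|h]; trivial;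
  [left; apply exp_increasing; exact h | rewrite h; lra].
Qed.

Lemma exp_sub1x_bound x : Rabs x <= 1 -> Rabs (exp x - 1 - x) <= 3 * (x * x).
Proof.
intros Hx.
destruct (MVT_cor4 (fun t => exp t - t) (fun t => exp t - 1) 0 1) with (b := x)
  as [c [H1 H2]].
{ intros c _; auto_derive; trivial; ring. }
{ rewrite Rminus_0_r; exact Hx. }
rewrite exp_0 in H1; rewrite !Rminus_0_r in *.
replace (exp x - 1 - x) with ((exp c - 1) * x) by lra.
rewrite Rabs_mult.
pose proof (exp_sub1_bound c ltac:(lra)).
replace (x * x) with (Rabs x * Rabs x) by (rewrite <- Rabs_mult; apply Rabs_pos_eq; nra).
pose proof (Rabs_pos x); pose proof (Rabs_pos c).
nra.
Qed.

Lemma cos_sub1_bound x : Rabs (cos x - 1) <= Rabs x * Rabs x.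
Proof.
destruct (MVT_cor4 cos (fun t => - sin t) 0 (Rabs x)) with (b := x) as [c [H1 H2]].
{ intros c _; auto_derive; trivial; ring. }
{ rewrite Rminus_0_r; lra. }
rewrite cos_0 in H1; rewrite !Rminus_0_r in *.
rewrite H1, Rabs_mult, Rabs_Ropp.
apply Rmult_le_compat_r; [apply Rabs_pos |].
apply Rle_trans with (2 := H2).
destruct (MVT_cor4 sin cos 0 (Rabs c)) with (b := c) as [d [H3 _]].
{ intros d _; auto_derive; trivial; ring. }
{ rewrite Rminus_0_r; lra. }
rewrite sin_0 in H3; rewrite !Rminus_0_r in *.
rewrite H3, Rabs_mult.
pose proof (Rabs_pos c); pose proof (COS_bound d).
assert (Rabs (cos d) <= 1) by (apply Rabs_le; lra).
nra.
Qed.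

Lemma sin_subx_bound x : Rabs x <= 1 -> Rabs (sin x - x) <= Rabs x * Rabs x.
Proof.
intros Hx.
destruct (MVT_cor4 (fun t => sin t - t) (fun t => cos t - 1) 0 1) with (b := x)
  as [c [H1 H2]].
{ intros c _; auto_derive; trivial; ring. }
{ rewrite Rminus_0_r; exact Hx. }
rewrite sin_0 in H1; rewrite !Rminus_0_r in *.
rewrite H1, Rabs_mult.
apply Rmult_le_compat_r; [apply Rabs_pos |].
pose proof (cos_sub1_bound c); pose proof (Rabs_pos c); nra.
Qed.

Lemma Cexp_quadratic (a : C) :
  Cmod a <= 1 -> Cmod (Cexp a - 1 - a)%C <= 16 * (Cmod a * Cmod a).
Proof.
intros Ha.
pose proof (Rmax_Cmod a) as Hm.
pose proof (Rmax_l (Rabs (fst a)) (Rabs (snd a))).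
pose proof (Rmax_r (Rabs (fst a)) (Rabs (snd a))).
assert (Hx : Rabs (fst a) <= Cmod a) by lra.
assert (Hy : Rabs (snd a) <= Cmod a) by lra.
set (m := Cmod a) in *; clearbody m.
destruct a as [x y]; simpl in *.
assert (He : exp x <= 4).
{ pose proof (exp_sub1_bound x ltac:(lra)) as h.
  pose proof (Rle_abs (exp x - 1)); lra. }
pose proof (exp_pos x).
pose proof (Rabs_pos x); pose proof (Rabs_pos y).
replace (16 * (m * m)) with (2 * (8 * (m * m))) by ring.
assert (Hyy : Rabs y * Rabs y <= m * m) by (apply Rmult_le_compat; lra).
assert (Hxy : Rabs x * Rabs y <= m * m) by (apply Rmult_le_compat; lra).
assert (Hxx : x * x <= m * m).
{ replace (x * x) with (Rabs x * Rabs x)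
    by (rewrite <- Rabs_mult; apply Rabs_pos_eq; nra).
  apply Rmult_le_compat; lra. }
apply Cmod_le_components; simpl.
- replace (_ + _) with ((exp x - 1 - x) + exp x * (cos y - 1)) by ring.
  eapply Rle_trans; [apply Rabs_triang |].
  rewrite Rabs_mult, (Rabs_pos_eq (exp x)) by lra.
  pose proof (exp_sub1x_bound x ltac:(lra)).
  pose proof (cos_sub1_bound y).
  assert (exp x * Rabs (cos y - 1) <= 4 * (m * m))
    by (apply Rmult_le_compat; [lra | apply Rabs_pos | lra | lra]).
  nra.
- replace (_ + _) with (exp x * (sin y - y) + (exp x - 1) * y) by ring.
  eapply Rle_trans; [apply Rabs_triang |].
  rewrite !Rabs_mult, (Rabs_pos_eq (exp x)) by lra.
  pose proof (exp_sub1_bound x ltac:(lra)).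
  pose proof (sin_subx_bound y ltac:(lra)).
  assert (exp x * Rabs (sin y - y) <= 4 * (m * m))
    by (apply Rmult_le_compat; [lra | apply Rabs_pos | lra | lra]).
  assert (Rabs (exp x - 1) * Rabs y <= (3 * Rabs x) * Rabs y)
    by (apply Rmult_le_compat_r; lra).
  nra.
Qed.

Lemma u_bracket_RtoC (k : nat) (lam x : R) :
  u_bracket k lam (RtoC x) =
  RtoC (lam + sqrt (2 * INR k - 2) * Erfc_R (sqrt ((INR k - 1) / 2) * x)).
Proof.
unfold u_bracket; rewrite <- RtoC_mult, Erfc_RtoC, <- RtoC_mult, <- RtoC_plus.
reflexivity.
Qed.

Lemma gauss_bound (M : R) (w : C) : Cmod w <= M -> Cmod (gauss w) <= exp (M * M).
Proof.
intros Hw; unfold gauss; rewrite Cmod_Cexp.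
assert (Re (- w ^ 2)%C <= M * M).
{ apply Rle_trans with (1 := Rle_abs _), Rle_trans with (1 := re_le_Cmod _).
  rewrite Cmod_opp, Cmod_pow; simpl; rewrite Rmult_1_r.
  apply Rmult_le_compat; trivial; apply Cmod_ge_0. }
destruct (Rle_lt_or_eq_dec _ _ H) as [h|h];
  [left; apply exp_increasing; exact h | rewrite h; lra].
Qed.

Lemma gauss_quadratic (M : R) (w d : C) :
  Cmod w <= M -> Cmod d <= 1 -> Cmod d * (2 * M + 1) <= 1 ->
  Cmod (gauss (w + d) - gauss w + 2 * w * d * gauss w)%C <=
    exp (M * M) * (16 * (2 * M + 1) ^ 2 + 1) * Cmod d ^ 2.
Proof.
intros Hw Hd1 Hd.
set (q := (- (2 * w * d + d * d))%C).
assert (E : gauss (w + d)%C = (gauss w * Cexp q)%C).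
{ unfold gauss, q; rewrite <- Cexp_plus; f_equal; ring. }
rewrite E.
replace (gauss w * Cexp q - gauss w + 2 * w * d * gauss w)%C
  with (gauss w * ((Cexp q - 1 - q) - d * d))%C by (unfold q; ring).
rewrite Cmod_mult, Rmult_assoc.
pose proof (Cmod_ge_0 w); pose proof (Cmod_ge_0 d).
assert (Hq : Cmod q <= (2 * M + 1) * Cmod d).
{ unfold q; rewrite Cmod_opp.
  eapply Rle_trans; [apply Cmod_triangle |].
  rewrite !Cmod_mult, Cmod_R, Rabs_pos_eq by lra.
  assert (Cmod w * Cmod d <= M * Cmod d) by (apply Rmult_le_compat_r; lra).
  nra. }
apply Rmult_le_compat; try apply Cmod_ge_0; [apply gauss_bound; exact Hw |].
unfold Cminus at 1.
eapply Rle_trans; [apply Cmod_triangle |].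
rewrite Cmod_opp, Cmod_mult.
pose proof (Cexp_quadratic q ltac:(lra)) as Hc.
pose proof (Cmod_ge_0 q).
assert (Cmod q * Cmod q <= ((2 * M + 1) * Cmod d) * ((2 * M + 1) * Cmod d))
  by (apply Rmult_le_compat; lra).
nra.
Qed.

Lemma gauss_seg_ftc z :
  is_RInt (V := C_R_NormedModule)
    (fun t : R => gauss (RtoC t * z) -
       RtoC t * (2 * z * (RtoC t * z) * gauss (RtoC t * z)))%C 0 1 (gauss z).
Proof.
destruct z as [x y].
set (A := fun t : R => t * (exp (t * t * (y * y - x * x)) * cos (- 2 * (t * t) * x * y))).
set (B := fun t : R => t * (exp (t * t * (y * y - x * x)) * sin (- 2 * (t * t) * x * y))).
assert (Ez : gauss (x, y) = (minus (A 1) (A 0), minus (B 1) (B 0))).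
{ pose proof (gauss_seg x y 1) as H; rewrite Cmult_1_l in H; rewrite H.
  unfold A, B, minus, plus, opp; simpl; f_equal; ring. }
rewrite Ez.
apply (is_RInt_fct_extend_pair (U := R_NormedModule) (V := R_NormedModule)).
- apply (is_RInt_ext (V := R_NormedModule)) with (f := Derive A).
  { intros t _; rewrite gauss_seg.
    apply is_derive_unique; unfold A; auto_derive; trivial; simpl; ring. }
  apply (is_RInt_derive (V := R_CompleteNormedModule)).
  + intros t _; apply Derive_correct; unfold A; auto_derive; trivial.
  + intros t _.
    apply (continuous_ext (fun t => 
      exp (t * t * (y * y - x * x)) * cos (- 2 * (t * t) * x * y) +
      t * (2 * t * (y * y - x * x) * exp (t * t * (y * y - x * x)) * cos (- 2 * (t * t) * x * y)
       + exp (t * t * (y * y - x * x)) * (4 * t * x * y * sin (- 2 * (t * t) * x * y))))).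
    { intros s; symmetry; apply is_derive_unique; unfold A; auto_derive; trivial; ring. }
    apply (ex_derive_continuous (K := R_AbsRing) (V := R_NormedModule)).
    auto_derive; trivial.
- apply (is_RInt_ext (V := R_NormedModule)) with (f := Derive B).
  { intros t _; rewrite gauss_seg.
    apply is_derive_unique; unfold B; auto_derive; trivial; simpl; ring. }
  apply (is_RInt_derive (V := R_CompleteNormedModule)).
  + intros t _; apply Derive_correct; unfold B; auto_derive; trivial.
  + intros t _.
    apply (continuous_ext (fun t => 
      exp (t * t * (y * y - x * x)) * sin (- 2 * (t * t) * x * y) +
      t * (2 * t * (y * y - x * x) * exp (t * t * (y * y - x * x)) * sin (- 2 * (t * t) * x * y)
       - exp (t * t * (y * y - x * x)) * (4 * t * x * y * cos (- 2 * (t * t) * x * y))))).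
    { intros s; symmetry; apply is_derive_unique; unfold B; auto_derive; trivial; ring. }
    apply (ex_derive_continuous (K := R_AbsRing) (V := R_NormedModule)).
    auto_derive; trivial.
Qed.

Lemma Erfc_quadratic (z : C) :
  exists K delta : R, 0 <= K /\ 0 < delta /\
    forall h : C, Cmod h <= delta ->
      Cmod (Erfc (z + h) - Erfc z + h * gauss z)%C <= K * Cmod h ^ 2.
Proof.
set (M := Cmod z).
assert (HM : 0 <= M) by apply Cmod_ge_0.
set (K1 := exp (M * M) * (16 * (2 * M + 1) ^ 2 + 1)).
assert (HK1 : 0 <= K1).
{ apply Rmult_le_pos; [left; apply exp_pos | nra]. }
set (K2 := K1 + 2 * M * exp (M * M)).
exists (M * K1 + (K1 + 2 * M * exp (M * M))), (/ (2 * M + 1)).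
pose proof (exp_pos (M * M)) as HE.
assert (0 < / (2 * M + 1)) by (apply Rinv_0_lt_compat; lra).
split; [| split; trivial].
{ assert (0 <= M * K1) by (apply Rmult_le_pos; lra).
  assert (0 <= M * exp (M * M)) by (apply Rmult_le_pos; lra). lra. }
intros h Hh.
assert (Hh2 : Cmod h * (2 * M + 1) <= 1).
{ apply Rle_trans with (/ (2 * M + 1) * (2 * M + 1)).
  - apply Rmult_le_compat_r; lra.
  - rewrite Rinv_l; lra. }
pose proof (Cmod_ge_0 h) as Hh0.
assert (Hh1 : Cmod h <= 1) by nra.
pose proof (is_RInt_Cmult (z + h) _ _ _ _ (gauss_seg_is_RInt (z + h)%C)) as I1.
pose proof (is_RInt_Cmult z _ _ _ _ (gauss_seg_is_RInt z)) as I2.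
pose proof (is_RInt_Cmult h _ _ _ _ (gauss_seg_ftc z)) as I3.
pose proof (is_RInt_minus (V := C_R_NormedModule) _ _ _ _ _ _ 
  (is_RInt_minus (V := C_R_NormedModule) _ _ _ _ _ _ I1 I2) I3) as I.
clear I1 I2 I3.
match type of I with is_RInt ?F _ _ ?L => set (f := F) in I; set (l := L) in I end.
replace (Erfc (z + h) - Erfc z + h * gauss z)%C with (- l)%C
  by (set (J := fun z : C => RInt (V := C_R_CompleteNormedModule)
        (fun t : R => gauss (RtoC t * z)%C) 0 1) in l;
      change l with (((z + h) * J (z + h)%C - z * J z) - h * gauss z)%C;
      change (- (((z + h) * J (z + h)%C - z * J z) - h * gauss z) =
        (RtoC (Erfc_R 0) - (z + h) * J (z + h)) - (RtoC (Erfc_R 0) - z * J z) + h * gauss z)%C;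
      ring).
rewrite Cmod_opp.
set (KK := M * K1 + (K1 + 2 * M * exp (M * M))).
pose proof (is_RInt_const (V := R_NormedModule) 0 1 (KK * Cmod h ^ 2)) as Ic.
replace (KK * Cmod h ^ 2) with (scal (1 - 0) (KK * Cmod h ^ 2))
  by (unfold scal; simpl; unfold mult; simpl; ring).
rewrite Cmod_norm.
refine (norm_RInt_le (V := C_R_NormedModule) f _ 0 1 l _ Rle_0_1 _ I Ic).
intros t [Ht0 Ht1].
eapply Rle_trans; [right; symmetry; apply Cmod_norm |].
set (w := (RtoC t * z)%C).
set (d := (RtoC t * h)%C).
set (Q := (gauss (w + d) - gauss w + 2 * w * d * gauss w)%C).
assert (Ef : @eq C (f t) (z * Q + h * (Q - 2 * w * d * gauss w))%C).
{ change (f t) with ((((z + h) * gauss (RtoC t * (z + h)) - z * gauss w) -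
    h * (gauss w - RtoC t * (2 * z * w * gauss w))))%C.
  unfold Q.
  replace (RtoC t * (z + h))%C with (w + d)%C by (unfold w, d; ring).
  unfold d; ring. }
rewrite Ef.
assert (Hw : Cmod w <= M).
{ unfold w; rewrite Cmod_mult, Cmod_R, Rabs_pos_eq by lra; fold M; nra. }
assert (Hd : Cmod d <= Cmod h).
{ unfold d; rewrite Cmod_mult, Cmod_R, Rabs_pos_eq by lra; nra. }
pose proof (Cmod_ge_0 d) as Hd0; pose proof (Cmod_ge_0 w) as Hw0.
assert (HQ : Cmod Q <= K1 * Cmod h ^ 2).
{ eapply Rle_trans; [apply (gauss_quadratic M); trivial; nra |].
  fold K1; apply Rmult_le_compat_l; trivial. apply pow_incr; lra. }
pose proof (gauss_bound M w Hw) as Hg.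
pose proof (Cmod_ge_0 Q); pose proof (Cmod_ge_0 (gauss w)).
eapply Rle_trans; [apply Cmod_triangle |].
rewrite !Cmod_mult; fold M.
assert (T : Cmod (Q - 2 * w * d * gauss w)%C <= K1 * Cmod h ^ 2 + 2 * M * Cmod h * exp (M * M)).
{ eapply Rle_trans; [apply Cmod_triangle |].
  rewrite Cmod_opp, !Cmod_mult, Cmod_R, (Rabs_pos_eq 2) by lra.
  apply Rplus_le_compat; trivial.
  apply Rmult_le_compat; trivial.
  - repeat apply Rmult_le_pos; lra.
  - apply Rmult_le_compat; lra. }
assert (M * Cmod Q <= M * (K1 * Cmod h ^ 2)) by (apply Rmult_le_compat_l; lra).
assert (Cmod h * Cmod (Q - 2 * w * d * gauss w)%C <=
  Cmod h * (K1 * Cmod h ^ 2 + 2 * M * Cmod h * exp (M * M)))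
  by (apply Rmult_le_compat_l; lra).
assert (Cmod h * (K1 * Cmod h ^ 2) <= 1 * (K1 * Cmod h ^ 2)).
{ apply Rmult_le_compat_r; trivial. apply Rmult_le_pos; nra. }
unfold KK; nra.
Qed.

Lemma Erfc_entire (z : C) :
  is_derive (K := C_AbsRing) (V := C_NormedModule) Erfc z (- Cexp (- z ^ 2))%C.
Proof.
split; [apply is_linear_scal_l |].
intros z' Hz'.
apply (is_filter_lim_locally_unique (K := C_AbsRing) (V := AbsRing_NormedModule C_AbsRing)) in Hz'.
subst z'; intros eps.
destruct (Erfc_quadratic z) as [K [delta [HK [Hdelta H]]]].
assert (He : 0 < eps / (K + 1)) by (apply Rdiv_lt_0_compat; [apply eps | lra]).
assert (Hm : 0 < Rmin delta (eps / (K + 1))) by (apply Rmin_case; trivial).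
exists (mkposreal _ Hm); intros y Hy; change C in y.
change (Cmod (y - z)%C < Rmin delta (eps / (K + 1))) in Hy.
change (Cmod ((Erfc y - Erfc z) - (y - z) * (- Cexp (- z ^ 2)))%C <= eps * Cmod (y - z)%C).
pose proof (Rmin_l delta (eps / (K + 1))); pose proof (Rmin_r delta (eps / (K + 1))).
specialize (H (y - z)%C ltac:(lra)).
replace (z + (y - z))%C with y in H by ring.
replace ((Erfc y - Erfc z) - (y - z) * (- Cexp (- z ^ 2)))%C
  with (Erfc y - Erfc z + (y - z) * gauss z)%C by (unfold gauss; ring).
apply Rle_trans with (1 := H).
pose proof (Cmod_ge_0 (y - z)%C).
assert (K * Cmod (y - z)%C <= eps).
{ apply Rle_trans with ((K + 1) * (eps / (K + 1))).
  - apply Rmult_le_compat; lra.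
  - right; field; lra. }
nra.
Qed.

(* Main.v *)
Require Import Defs.
From Stdlib Require Import Reals Lra Lia Psatz IndefiniteDescription.
From Coquelicot Require Import Coquelicot.
Open Scope R_scope.

(** After the scaling w = sqrt((k-1)/2) z, which preserves arguments, a
    singularity is a solution of Erfc(w) = -mu with
    mu = lam / sqrt(2k-2) > 0.  In the right half-plane
    Erfc(w) = e^{-w^2} (1 + O((Re w)^{-2})) / (2w), and the equation
    e^{-w^2} = -2 mu w has solutions close to the ray arg w = pi/4.  Writing
    w = e^{i pi/4} (r + i s), one has -w^2 = 2rs - i (r^2 - s^2), so that up
    to errors tending to 0 the modulus requires e^{2rs} = 2 mu r and the
    argument requires r^2 = 3 pi/4 modulo 2 pi.  Hence
    s = ln(2 mu r) / (2r), which is positive for large r and o(r): the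
    solutions lie strictly beyond the ray arg w = pi/4, while their arguments
    tend to pi/4.  Every mu > 0 thus produces singularities in the first of
    the two sectors.

    Three facts turn this heuristic into a proof.

    - [Erfc_asymptotic] bounds 2 w Erfc(w) - e^{-w^2}.  With the factor 2w
      frozen at the starting point w0, the derivative of
      2 w0 Erfc(w) - e^{-w^2} is 2 (w - w0) e^{-w^2}.  This is integrated along
      the horizontal ray from w0 towards +infinity, on which the function
      tends to 0, by means of the mean value inequality [Cmod_increment_le].

    - [Erfc_preimage_near] makes an approximate solution p exact.  Since
      Erfc' = -e^{-w^2}, the simplified Newton map
      w + e^{p^2} (Erfc(w) - c) contracts a disc of radius 1 / (48 |p|) as soon
      as 2p (Erfc(p) - c) is small relative to e^{-p^2}.

    - [approximate_preimage] checks that the points p = e^{i pi/4} (r + i s)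
      above are good enough.  The correction, at most 1 / (48 r), is smaller
      than s, which is at least 1 / (2r); the exact solution therefore stays
      on the correct side of the ray. *)

(** * Complex derivatives and the mean value inequality *)

Lemma is_derive_of_quadratic (F : C -> C) (z l : C) (K delta : R) :
  0 <= K -> 0 < delta ->
  (forall h : C, Cmod h <= delta -> Cmod (F (z + h) - F z - h * l)%C <= K * Cmod h ^ 2) ->
  is_derive (K := C_AbsRing) (V := C_NormedModule) F z l.
Proof.
intros HK Hdelta H.
split; [apply is_linear_scal_l |].
intros z' Hz'.
apply (is_filter_lim_locally_unique (K := C_AbsRing) (V := AbsRing_NormedModule C_AbsRing)) in Hz'.
subst z'; intros eps.
assert (He : 0 < eps / (K + 1)) by (apply Rdiv_lt_0_compat; [apply eps | lra]).
assert (Hm : 0 < Rmin delta (eps / (K + 1))) by (apply Rmin_case; trivial).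
exists (mkposreal _ Hm); intros y Hy; change C in y.
change (Cmod (y - z)%C < Rmin delta (eps / (K + 1))) in Hy.
change (Cmod ((F y - F z) - (y - z) * l)%C <= eps * Cmod (y - z)%C).
pose proof (Rmin_l delta (eps / (K + 1))); pose proof (Rmin_r delta (eps / (K + 1))).
specialize (H (y - z)%C ltac:(lra)).
replace (z + (y - z))%C with y in H by ring.
apply Rle_trans with (1 := H).
pose proof (Cmod_ge_0 (y - z)%C).
assert (K * Cmod (y - z)%C <= eps).
{ apply Rle_trans with ((K + 1) * (eps / (K + 1))).
  - apply Rmult_le_compat; lra.
  - right; field; lra. }
nra.
Qed.

Lemma is_derive_gauss (z : C) :
  is_derive (K := C_AbsRing) (V := C_NormedModule) gauss z (- (2 * z * gauss z))%C.
Proof.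
pose proof (Cmod_ge_0 z) as HM.
assert (H0 : 0 < / (2 * Cmod z + 1)) by (apply Rinv_0_lt_compat; lra).
apply is_derive_of_quadratic with
  (K := exp (Cmod z * Cmod z) * (16 * (2 * Cmod z + 1) ^ 2 + 1))
  (delta := / (2 * Cmod z + 1)); trivial.
{ apply Rmult_le_pos; [left; apply exp_pos | nra]. }
intros h Hh.
assert (Hh2 : Cmod h * (2 * Cmod z + 1) <= 1).
{ apply Rle_trans with (/ (2 * Cmod z + 1) * (2 * Cmod z + 1)).
  - apply Rmult_le_compat_r; lra.
  - rewrite Rinv_l; lra. }
pose proof (Cmod_ge_0 h).
replace (gauss (z + h) - gauss z - h * - (2 * z * gauss z))%C
  with (gauss (z + h) - gauss z + 2 * z * h * gauss z)%C by ring.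
apply gauss_quadratic; trivial; nra.
Qed.

(** The product rule is available for the normed module that [C] carries as an
    absolute ring.  That structure and [C_NormedModule] have the same norm but
    different balls; the little-o condition only sees the norm. *)
Lemma is_derive_Cmult_l (F : C -> C) (z c l : C) :
  is_derive (K := C_AbsRing) (V := C_NormedModule) F z l ->
  is_derive (K := C_AbsRing) (V := C_NormedModule) (fun t => c * F t)%C z (c * l)%C.
Proof.
intros [_ H].
assert (H' : is_derive (K := C_AbsRing) (V := AbsRing_NormedModule C_AbsRing) F z l).
{ split; [apply is_linear_scal_l | exact H]. }
pose proof (is_derive_mult (K := C_AbsRing) _ F z _ l (is_derive_const (V := AbsRing_NormedModule C_AbsRing) c z) H' Cmult_comm) as [_ G].
split; [apply is_linear_scal_l |].
replace (c * l)%C with (0 * F z + c * l)%C by ring.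
exact G.
Qed.

Lemma is_derive_along_line (F : C -> C) (a d u l : C) (s : R) :
  is_derive (K := C_AbsRing) (V := C_NormedModule) F (a + RtoC s * d)%C l ->
  is_derive (fun t : R => fst (u * F (a + RtoC t * d))%C) s (fst (u * (d * l))%C).
Proof.
intros [_ H].
split; [apply is_linear_scal_l |].
intros s' Hs'.
apply (is_filter_lim_locally_unique (K := R_AbsRing) (V := R_NormedModule)) in Hs'.
subst s'; intros eps.
set (z := (a + RtoC s * d)%C) in *.
specialize (H z (fun P HP => HP)).
set (k := (Cmod u + 1) * (Cmod d + 1)).
pose proof (Cmod_ge_0 u); pose proof (Cmod_ge_0 d).
assert (Hk : 0 < k) by (apply Rmult_lt_0_compat; lra).
assert (He : 0 < eps / k) by (apply Rdiv_lt_0_compat; [apply eps | lra]).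
destruct (H (mkposreal _ He)) as [[delta Hd] HD].
assert (Hm : 0 < delta / (Cmod d + 1)) by (apply Rdiv_lt_0_compat; lra).
exists (mkposreal _ Hm); intros t Ht; change R in t.
change (Rabs (t - s) < delta / (Cmod d + 1)) in Ht.
change (Rabs ((fst (u * F (a + RtoC t * d))%C - fst (u * F z)%C) - (t - s) * fst (u * (d * l))%C)
  <= eps * Rabs (t - s)).
set (y := (a + RtoC t * d)%C).
assert (Ey : (y - z = RtoC (t - s) * d)%C) by (unfold y, z; rewrite RtoC_minus; ring).
assert (Hyz : Cmod (y - z)%C = Rabs (t - s) * Cmod d) by (rewrite Ey, Cmod_mult, Cmod_R; reflexivity).
pose proof (Rabs_pos (t - s)).
assert (Hb : Cmod (y - z)%C < delta).
{ rewrite Hyz. apply Rle_lt_trans with (Rabs (t - s) * (Cmod d + 1)); [nra |].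
  apply Rlt_le_trans with (delta / (Cmod d + 1) * (Cmod d + 1)).
  - apply Rmult_lt_compat_r; lra.
  - right; field; lra. }
specialize (HD y Hb).
change (Cmod ((F y - F z) - (y - z) * l)%C <= eps / k * Cmod (y - z)%C) in HD.
replace ((fst (u * F y)%C - fst (u * F z)%C) - (t - s) * fst (u * (d * l))%C)
  with (fst (u * ((F y - F z) - (y - z) * l))%C)
  by (rewrite Ey; simpl; ring).
apply Rle_trans with (1 := re_le_Cmod _).
rewrite Cmod_mult.
apply Rle_trans with (Cmod u * (eps / k * Cmod (y - z)%C)).
{ apply Rmult_le_compat_l; trivial. }
rewrite Hyz.
replace (eps * Rabs (t - s)) with (eps / k * Rabs (t - s) * k) by (field; lra).
replace (Cmod u * (eps / k * (Rabs (t - s) * Cmod d)))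
  with (eps / k * Rabs (t - s) * (Cmod u * Cmod d)) by ring.
apply Rmult_le_compat_l; [apply Rmult_le_pos; lra | unfold k; nra].
Qed.

(** The phase that rotates an increment onto the positive real axis: it reduces
    complex-valued mean value estimates to real-valued ones. *)
Lemma exists_phase (v : C) : exists u : C, Cmod u = 1 /\ fst (u * v)%C = Cmod v.
Proof.
destruct (Ceq_dec v 0) as [-> | Hv].
{ exists 1%C; rewrite Cmod_1, Cmod_0; split; simpl; ring. }
pose proof (proj1 (Cmod_gt_0 v) Hv) as H.
assert (Hr : RtoC (Cmod v) <> 0%C) by (intros E; apply RtoC_inj in E; lra).
exists (Cconj v / Cmod v)%C; split.
- rewrite Cmod_div, Cmod_conj, Cmod_R, Rabs_pos_eq by (trivial; lra). field; lra.
- replace (Cconj v / Cmod v * v)%C with (RtoC (Cmod v)); [reflexivity |].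
  replace (Cconj v / Cmod v * v)%C with (v * Cconj v / Cmod v)%C by (field; trivial).
  rewrite <- Cmod2_conj, RtoC_pow. field; trivial.
Qed.

(** After multiplication by the phase of the increment, this is the
    monotonicity of h minus the real part of the rotated function. *)
Lemma Cmod_increment_le (F F' : C -> C) (h h' : R -> R) (a d : C) (T : R) :
  0 <= T ->
  (forall z, is_derive (K := C_AbsRing) (V := C_NormedModule) F z (F' z)) ->
  (forall s, is_derive h s (h' s)) ->
  (forall s, 0 <= s <= T -> Cmod (d * F' (a + RtoC s * d))%C <= h' s) ->
  Cmod (F (a + RtoC T * d) - F a)%C <= h T - h 0.
Proof.
intros HT HF Hh Hb.
destruct (exists_phase (F (a + RtoC T * d) - F a)%C) as [u [Hu1 Hu2]].
assert (HD : forall s, is_derive (fun s => h s - fst (u * F (a + RtoC s * d))%C) s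
   (h' s - fst (u * (d * F' (a + RtoC s * d)))%C)).
{ intros s; apply (is_derive_minus (V := R_NormedModule)); [apply Hh |].
  apply is_derive_along_line, HF. }
destruct (MVT_gen _ 0 T _ (fun s _ => HD s)) as [c [Hc E]].
{ intros s _; apply derivable_continuous_pt.
  eexists; apply is_derive_Reals, HD. }
rewrite Rmin_left, Rmax_right in Hc by lra.
assert (fst (u * (d * F' (a + RtoC c * d)))%C <= h' c).
{ apply Rle_trans with (1 := Rle_abs _), Rle_trans with (1 := re_le_Cmod _).
  rewrite Cmod_mult, Hu1, Rmult_1_l; auto. }
rewrite <- Hu2.
replace (a + RtoC 0 * d)%C with a in E by ring.
replace (fst (u * (F (a + RtoC T * d) - F a))%C)
  with (fst (u * F (a + RtoC T * d))%C - fst (u * F a)%C) by (simpl; ring).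
nra.
Qed.

(** * A fixed point theorem *)

(** Banach's theorem on a closed disc: the iterates of the centre stay in the
    disc because their steps are dominated by r/2, r/4, r/8, ..., whose sum
    is r. *)
Lemma contraction_fixed_point (Phi : C -> C) (p : C) (r : R) :
  (forall a b, Cmod (a - p) <= r -> Cmod (b - p) <= r ->
     Cmod (Phi a - Phi b) <= / 2 * Cmod (a - b)) ->
  Cmod (Phi p - p) <= r / 2 ->
  exists w, Cmod (w - p) <= r /\ Phi w = w.
Proof.
intros Hlip Hp.
pose proof (Cmod_ge_0 (Phi p - p)) as Hr.
set (w := fun n => Nat.iter n Phi p).
assert (Hn : forall n, Cmod (w n - p) <= r * (1 - (/ 2) ^ n) /\
   Cmod (w (S n) - w n) <= r / 2 * (/ 2) ^ n).
{ induction n as [|n [I1 I2]].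
  - simpl; split; [| lra].
    replace (p - p)%C with (RtoC 0) by ring. rewrite Cmod_0; lra.
  - assert (H1 : Cmod (w (S n) - p) <= r * (1 - (/ 2) ^ S n)).
    { replace (w (S n) - p)%C with ((w (S n) - w n) + (w n - p))%C by ring.
      apply Rle_trans with (1 := Cmod_triangle _ _). 
      change ((/2) ^ S n) with (/ 2 * (/2) ^ n). lra. }
    split; trivial.
    assert (Hq : forall m, 0 <= (/ 2) ^ m) by (intros; apply pow_le; lra).
    apply Rle_trans with (/ 2 * Cmod (w (S n) - w n)).
    + apply (Hlip (w (S n)) (w n)).
      * apply Rle_trans with (1 := H1). specialize (Hq (S n)); nra.
      * apply Rle_trans with (1 := I1). specialize (Hq n); nra.
    + change ((/2) ^ S n) with (/ 2 * (/2) ^ n). lra. }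
assert (Hin : forall n, Cmod (w n - p) <= r).
{ intros n; apply Rle_trans with (1 := proj1 (Hn n)).
  assert (0 <= (/ 2) ^ n) by (apply pow_le; lra); nra. }
destruct (ex_series_le (K := R_AbsRing) (V := C_R_CompleteNormedModule)
   (fun n => w (S n) - w n)%C (fun n => r / 2 * (/ 2) ^ n)) as [l Hl].
{ intros n. eapply Rle_trans; [right; symmetry; apply Cmod_norm | apply Hn]. }
{ apply (ex_series_scal_l (K := R_AbsRing) (V := R_NormedModule)), ex_series_geom.
  rewrite Rabs_pos_eq; lra. }
set (W := (l + p)%C).
(* W is the limit of the iterates, obtained as p plus the sum of the steps. *)
assert (Hlim : forall eps, 0 < eps -> exists n, Cmod (w (S n) - W) < eps /\ Cmod (w n - W) < eps).
{ intros eps He.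
  assert (HN : exists N, forall n, (N <= n)%nat -> Cmod (w (S n) - W) < eps).
  { destruct (Hl _ (locally_ball_norm (K := R_AbsRing) (V := C_R_NormedModule) l (mkposreal _ He)))
      as [N HN].
    exists N; intros n Hn'. specialize (HN n Hn').
    unfold ball_norm in HN; simpl pos in HN.
    rewrite <- Cmod_norm in HN.
    replace (w (S n) - W)%C with (minus (sum_n (fun n => w (S n) - w n)%C n) l : C); trivial.
    change (sum_n (G := C_AbelianMonoid) (fun n => w (S n) - w n)%C n - l = w (S n) - W)%C.
    assert (E : sum_n (G := C_AbelianMonoid) (fun n => w (S n) - w n)%C n = (w (S n) - p)%C).
    { clear. induction n as [|n IH].
      - rewrite sum_O; reflexivity.
      - rewrite sum_Sn, IH. change (((w (S n) - p) + (w (S (S n)) - w (S n)))%C = (w (S (S n)) - p)%C :> C). ring. }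
    rewrite E; unfold W; ring. }
  destruct HN as [N HN]; exists (S N); split; apply HN; lia. }
assert (HW : Cmod (W - p) <= r).
{ apply le_epsilon; intros eps He.
  destruct (Hlim eps He) as [n [_ H]].
  replace (W - p)%C with ((w n - p) - (w n - W))%C by ring.
  apply Rle_trans with (1 := Cmod_triangle _ _).
  rewrite Cmod_opp. specialize (Hin n); lra. }
exists W; split; trivial.
assert (H0 : Cmod (Phi W - W) <= 0).
{ apply le_epsilon; intros eps He.
  destruct (Hlim (eps / 2) ltac:(lra)) as [n [H1 H2]].
  replace (Phi W - W)%C with ((w (S n) - W) - (w (S n) - Phi W))%C by ring.
  apply Rle_trans with (1 := Cmod_triangle _ _).
  rewrite Cmod_opp.
  assert (Cmod (w (S n) - Phi W) <= / 2 * Cmod (w n - W)) by (apply (Hlip (w n) W); trivial).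
  pose proof (Cmod_ge_0 (w n - W)). lra. }
assert (E : (Phi W - W)%C = 0%C).
{ apply Cmod_eq_0; pose proof (Cmod_ge_0 (Phi W - W)); lra. }
replace (Phi W) with ((Phi W - W) + W)%C by ring. rewrite E; ring.
Qed.

(** * Asymptotics of Erfc in the right half-plane *)

Lemma Cmod_gauss (x y : R) : Cmod (gauss (x, y)) = exp (y * y - x * x).
Proof. unfold gauss; rewrite Cmod_Cexp; f_equal; simpl; ring. Qed.

Lemma gauss_vanishes_right (y eps : R) :
  0 < eps -> exists X, forall x, X <= x -> Cmod (gauss (x, y)) <= eps.
Proof.
intros He.
exists (Rmax 1 (exp (y * y) / eps)); intros x Hx.
pose proof (Rmax_l 1 (exp (y * y) / eps)); pose proof (Rmax_r 1 (exp (y * y) / eps)).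
rewrite Cmod_gauss; unfold Rminus; rewrite exp_plus, exp_Ropp.
pose proof (exp_ineq1_le (x * x)).
assert (Hxe : exp (y * y) <= x * eps).
{ replace (exp (y * y)) with (exp (y * y) / eps * eps) by (field; lra).
  apply Rmult_le_compat_r; lra. }
apply Rle_trans with (x * eps * / exp (x * x)).
{ apply Rmult_le_compat_r; trivial; left; apply Rinv_0_lt_compat, exp_pos. }
replace eps with (exp (x * x) * eps * / exp (x * x)) at 2
  by (field; apply Rgt_not_eq, exp_pos).
apply Rmult_le_compat_r; [left; apply Rinv_0_lt_compat, exp_pos |].
apply Rmult_le_compat_r; nra.
Qed.

Lemma Erfc_R_split (t : R) :
  Erfc_R 0 = RInt (fun v => exp (- v ^ 2)) 0 t + Erfc_R t.
Proof.
apply (is_RInt_gen_unique (V := R_CompleteNormedModule)).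
apply (is_RInt_gen_Chasles (V := R_NormedModule)) with (b := t).
- apply is_RInt_gen_at_point, (RInt_correct (V := R_CompleteNormedModule)), gauss_ex_RInt.
- apply Erfc_R_correct.
Qed.

Lemma Erfc_R_vanishes (eps : R) :
  0 < eps -> exists X, forall x, X <= x -> Rabs (Erfc_R x) <= eps.
Proof.
intros He.
destruct (Erfc_R_correct 0 _ (locally_ball (Erfc_R 0) (mkposreal _ He)))
  as [Q S HQ [X HX] H].
exists (X + 1); intros x Hx.
destruct (H 0 x HQ (HX x ltac:(lra))) as [v [Hv1 Hv2]].
apply (is_RInt_unique (V := R_CompleteNormedModule)) in Hv1.
simpl in Hv1; subst v.
change (Rabs (RInt (fun v => exp (- v ^ 2)) 0 x - Erfc_R 0) < eps) in Hv2.
rewrite (Erfc_R_split x), Rabs_minus_sym in Hv2.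
match type of Hv2 with Rabs ?e < _ => replace e with (Erfc_R x) in Hv2 by ring end.
lra.
Qed.

(** Integrating vertically from the real point x to x + i y costs at most
    y e^{y^2 - x^2}, and Erfc vanishes at +infinity on the real line. *)
Lemma Erfc_vanishes_right (y eps : R) :
  0 <= y -> 0 < eps -> exists X, forall x, X <= x -> Cmod (Erfc (x, y)) <= eps.
Proof.
intros Hy He.
destruct (Erfc_R_vanishes (eps / 2) ltac:(lra)) as [X1 H1].
assert (He' : 0 < eps / (2 * (y + 1))) by (apply Rdiv_lt_0_compat; lra).
destruct (gauss_vanishes_right y _ He') as [X2 H2].
exists (Rmax X1 X2); intros x Hx.
pose proof (Rmax_l X1 X2); pose proof (Rmax_r X1 X2).
specialize (H1 x ltac:(lra)); specialize (H2 x ltac:(lra)).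
assert (E : (x, y) = (RtoC x + RtoC y * Ci)%C) by (unfold Cplus, Cmult; simpl; f_equal; ring).
pose proof (Cmod_increment_le Erfc (fun z => - gauss z)%C
  (fun s => s * Cmod (gauss (x, y))) (fun _ => Cmod (gauss (x, y))) x Ci y Hy Erfc_entire)
  as HI.
rewrite <- E, Erfc_RtoC in HI.
assert (HI' : Cmod (Erfc (x, y) - Erfc_R x)%C <= y * Cmod (gauss (x, y)) - 0 * Cmod (gauss (x, y))).
{ apply HI.
  - intros s; auto_derive; trivial; ring.
  - intros s Hs. rewrite Cmod_mult, Cmod_opp, Cmod_Ci, Rmult_1_l.
    replace (RtoC x + RtoC s * Ci)%C with (x, s) by (unfold Cplus, Cmult; simpl; f_equal; ring).
    rewrite !Cmod_gauss.
    destruct (Rle_lt_or_eq_dec (s * s - x * x) (y * y - x * x)) as [h|h]; [nra | |];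
      [left; apply exp_increasing; exact h | rewrite h; lra]. }
replace (Erfc (x, y)) with ((Erfc (x, y) - Erfc_R x) + Erfc_R x)%C by ring.
apply Rle_trans with (1 := Cmod_triangle _ _).
rewrite Cmod_R.
assert (y * Cmod (gauss (x, y)) <= (y + 1) * (eps / (2 * (y + 1)))).
{ apply Rmult_le_compat; trivial; [apply Cmod_ge_0 | lra]. }
replace ((y + 1) * (eps / (2 * (y + 1)))) with (eps / 2) in * by (field; lra).
lra.
Qed.

(** Write w0 for (x, y).  The factor 2 w0 is kept constant while the
    argument moves to w0 + s, so that the derivative 2 s e^{-(w0+s)^2} contains
    no quotient; its modulus is at most 2 s e^{-2xs} |e^{-w0^2}|, whose integral
    over s > 0 is |e^{-w0^2}| / (2 x^2). *)
Lemma Erfc_asymptotic (x y : R) :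
  0 < x -> 0 <= y ->
  Cmod (2 * (x, y) * Erfc (x, y) - gauss (x, y))%C <= Cmod (gauss (x, y)) / (2 * x ^ 2).
Proof.
intros Hx Hy.
set (w := (x, y) : C); set (g := Cmod (gauss w)).
set (F := fun z => (2 * w * Erfc z - gauss z)%C).
change (Cmod (F w) <= g / (2 * x ^ 2)).
assert (HF : forall z, is_derive (K := C_AbsRing) (V := C_NormedModule) F z
   (2 * (z - w) * gauss z)%C).
{ intros z.
  replace (2 * (z - w) * gauss z)%C
    with ((2 * w) * (- gauss z) - - (2 * z * gauss z))%C by ring.
  apply (is_derive_minus (V := C_NormedModule)); [| apply is_derive_gauss].
  apply is_derive_Cmult_l, Erfc_entire. }
assert (Hg : 0 <= g) by apply Cmod_ge_0.
apply le_epsilon; intros eps He.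
set (m := 2 * Cmod w + 1).
assert (Hm : 1 <= m) by (unfold m; pose proof (Cmod_ge_0 w); lra).
assert (He2 : 0 < eps / (2 * m)) by (apply Rdiv_lt_0_compat; lra).
destruct (Erfc_vanishes_right y _ Hy He2) as [X1 H1].
destruct (gauss_vanishes_right y (eps / 2) ltac:(lra)) as [X2 H2].
set (T := Rmax 0 (Rmax X1 X2)).
pose proof (Rmax_l 0 (Rmax X1 X2)); pose proof (Rmax_r 0 (Rmax X1 X2)).
pose proof (Rmax_l X1 X2); pose proof (Rmax_r X1 X2).
fold T in H, H0.
assert (Hw : forall s, (w + RtoC s * 1)%C = (x + s, y))
  by (intros s; unfold w, Cplus, Cmult; simpl; f_equal; ring).
(* h is the primitive of the bound 2 s g e^{-2xs} that vanishes at
   +infinity. *)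
set (h := fun s => - g * (s / x + / (2 * x ^ 2)) * exp (- 2 * x * s)).
set (h' := fun s => 2 * s * (g * exp (- 2 * x * s))).
pose proof (Cmod_increment_le F _ h h' w 1 T ltac:(lra) HF) as HI.
assert (HI' : Cmod (F (w + RtoC T * 1) - F w)%C <= h T - h 0).
{ apply HI.
  - intros s; unfold h, h'; auto_derive; trivial; field; lra.
  - intros s Hs. unfold h'.
    replace (w + RtoC s * 1 - w)%C with (RtoC s) by ring.
    rewrite Cmult_1_l, !Cmod_mult, !Cmod_R, !Rabs_pos_eq by lra.
    apply Rmult_le_compat_l; [lra |].
    rewrite Hw; unfold g, w; rewrite !Cmod_gauss, <- exp_plus.
    destruct (Rle_lt_or_eq_dec (y * y - (x + s) * (x + s)) (y * y - x * x + - 2 * x * s))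
      as [k|k]; [nra | |]; [left; apply exp_increasing; exact k | rewrite k; lra]. }
assert (Hh : h T - h 0 <= g / (2 * x ^ 2)).
{ assert (h T <= 0).
  { unfold h.
    assert (0 <= g * (T / x + / (2 * x ^ 2)) * exp (-2 * x * T)); [| lra].
    repeat apply Rmult_le_pos; trivial; [| left; apply exp_pos].
    apply Rplus_le_le_0_compat.
    - apply Rmult_le_pos; [lra | left; apply Rinv_0_lt_compat; lra].
    - left; apply Rinv_0_lt_compat; nra. }
  assert (h 0 = - (g / (2 * x ^ 2))).
  { unfold h; rewrite Rmult_0_r, exp_0; field; lra. }
  lra. }
assert (HFT : Cmod (F (w + RtoC T * 1)%C) <= eps).
{ unfold F; rewrite Hw.
  specialize (H1 (x + T) ltac:(lra)); specialize (H2 (x + T) ltac:(lra)).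
  apply Rle_trans with (1 := Cmod_triangle _ _).
  rewrite Cmod_opp, !Cmod_mult, Cmod_R, Rabs_pos_eq by lra.
  assert (2 * Cmod w * Cmod (Erfc (x + T, y)) <= m * (eps / (2 * m))).
  { apply Rmult_le_compat; trivial; try apply Cmod_ge_0;
      unfold m; pose proof (Cmod_ge_0 w); lra. }
  replace (m * (eps / (2 * m))) with (eps / 2) in * by (field; lra).
  lra. }
replace (F w) with (F (w + RtoC T * 1) - (F (w + RtoC T * 1) - F w))%C by ring.
apply Rle_trans with (1 := Cmod_triangle _ _).
rewrite Cmod_opp; lra.
Qed.

(** * From approximate to exact preimages under Erfc *)

Lemma Cmod_1_minus_Cexp_le (q : C) : Cmod q <= / 16 -> Cmod (1 - Cexp q)%C <= 2 * Cmod q.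
Proof.
intros Hq. pose proof (Cmod_ge_0 q).
pose proof (Cexp_quadratic q ltac:(lra)).
replace (1 - Cexp q)%C with (- ((Cexp q - 1 - q) + q))%C by ring.
rewrite Cmod_opp. apply Rle_trans with (1 := Cmod_triangle _ _). nra.
Qed.

(** Newton's iteration with the derivative of Erfc frozen at p.  The iteration
    map has derivative 1 - e^{p^2 - w^2}, and within 1 / (48 |p|) of p the
    exponent is at most 1/16 in modulus, so the map halves distances. *)
Lemma Erfc_preimage_near (p c : C) :
  1 <= Cmod p ->
  Cmod (2 * p * (Erfc p - c))%C <= / 48 * Cmod (gauss p) ->
  exists w, Cmod (w - p) <= / (48 * Cmod p) /\ Erfc w = c.
Proof.
intros Hp Hc.
set (E := Cexp (p ^ 2)%C).
assert (HE : forall w, (E * gauss w = Cexp (p ^ 2 - w ^ 2))%C)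
  by (intros w; unfold E, gauss; rewrite <- Cexp_plus; reflexivity).
assert (HEp : (E * gauss p = 1)%C).
{ rewrite HE. replace (p ^ 2 - p ^ 2)%C with (RtoC 0) by ring.
  unfold Cexp; simpl; rewrite exp_0, cos_0, sin_0; unfold RtoC; f_equal; ring. }
set (Phi := fun w => (w + E * (Erfc w - c))%C).
set (r := / (48 * Cmod p)).
assert (Hr0 : 0 < r) by (apply Rinv_0_lt_compat; lra).
assert (Hr : r * Cmod p = / 48) by (unfold r; field; lra).
assert (HEn : Cmod E * Cmod (gauss p) = 1) by (rewrite <- Cmod_mult, HEp; apply Cmod_1).
destruct (contraction_fixed_point Phi p r) as [w [Hw1 Hw2]].
- assert (HD : forall z, is_derive (K := C_AbsRing) (V := C_NormedModule) Phi z
     (1 - E * gauss z)%C).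
  { intros z.
    replace (1 - E * gauss z)%C with (1 + E * (- gauss z - 0))%C by ring.
    apply (is_derive_plus (V := C_NormedModule)).
    { apply (is_derive_of_quadratic _ z 1%C 0 1); [lra | lra |].
      intros h _. replace (z + h - z - h * 1)%C with (RtoC 0) by ring.
      rewrite Cmod_0; lra. }
    apply is_derive_Cmult_l.
    apply (is_derive_minus (V := C_NormedModule)); [apply Erfc_entire |].
    apply (is_derive_const (V := C_NormedModule)). }
  intros a b Ha Hb.
  pose proof (Cmod_increment_le Phi _ (fun s => s * (/ 2 * Cmod (a - b)))
    (fun _ => / 2 * Cmod (a - b)) b (a - b)%C 1 Rle_0_1 HD) as HI.
  replace (b + RtoC 1 * (a - b))%C with a in HI by ring.
  replace (/ 2 * Cmod (a - b)) with
    (1 * (/ 2 * Cmod (a - b)) - 0 * (/ 2 * Cmod (a - b))) by ring.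
  apply HI.
  + intros s; auto_derive; trivial; ring.
  + intros s Hs.
    rewrite Cmod_mult, Rmult_comm; apply Rmult_le_compat_r; [apply Cmod_ge_0 |].
    set (z := (b + RtoC s * (a - b))%C).
    assert (Hz : Cmod (z - p) <= r).
    { replace (z - p)%C with (RtoC s * (a - p) + RtoC (1 - s) * (b - p))%C
        by (unfold z; rewrite RtoC_minus; ring).
      apply Rle_trans with (1 := Cmod_triangle _ _).
      rewrite !Cmod_mult, !Cmod_R, !Rabs_pos_eq by lra. nra. }
    rewrite HE.
    assert (Hq : Cmod (p ^ 2 - z ^ 2)%C <= / 16).
    { replace (p ^ 2 - z ^ 2)%C with (- ((z - p) * (2 * p + (z - p))))%C by ring.
      rewrite Cmod_opp, Cmod_mult.
      assert (Cmod (2 * p + (z - p))%C <= 3 * Cmod p).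
      { apply Rle_trans with (1 := Cmod_triangle _ _).
        rewrite Cmod_mult, Cmod_R, Rabs_pos_eq by lra. nra. }
      pose proof (Cmod_ge_0 (z - p)).
      apply Rle_trans with (r * (3 * Cmod p)); [| lra].
      apply Rmult_le_compat; trivial; apply Cmod_ge_0. }
    pose proof (Cmod_1_minus_Cexp_le _ Hq). lra.
- replace (Phi p - p)%C with (E * (Erfc p - c))%C by (unfold Phi; ring).
  rewrite !Cmod_mult, Cmod_R, Rabs_pos_eq in Hc by lra.
  rewrite Cmod_mult.
  pose proof (Cmod_ge_0 E).
  assert (Cmod E * (2 * Cmod p * Cmod (Erfc p - c)) <= / 48).
  { apply Rle_trans with (Cmod E * (/ 48 * Cmod (gauss p)));
      [apply Rmult_le_compat_l; trivial | right].
    rewrite <- (Rmult_1_r (/ 48)) at 2. rewrite <- HEn; ring. }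
  apply Rmult_le_reg_r with (2 * Cmod p); [lra |].
  nra.
- exists w; split; trivial.
  unfold Phi in Hw2.
  assert (Hz : (E * (Erfc w - c))%C = 0%C).
  { replace (E * (Erfc w - c))%C with ((w + E * (Erfc w - c)) - w)%C by ring.
    rewrite Hw2; ring. }
  replace (Erfc w) with ((E * gauss p) * (Erfc w - c) + c)%C by (rewrite HEp; ring).
  replace (E * gauss p * (Erfc w - c) + c)%C with (gauss p * (E * (Erfc w - c)) + c)%C by ring.
  rewrite Hz; ring.
Qed.

(** * Approximate solutions next to the ray of argument pi/4 *)

(** The eighth root of unity e^{i pi/4}. *)
Definition omega : C := (/ sqrt 2, / sqrt 2).

Lemma inv_sqrt2_sq : / sqrt 2 * / sqrt 2 = / 2.
Proof. rewrite <- Rinv_mult, sqrt_sqrt; lra. Qed.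

Lemma omega_sq : (omega * omega = Ci)%C.
Proof.
unfold omega, Cmult, Ci; simpl; rewrite !inv_sqrt2_sq; f_equal; lra.
Qed.

Lemma Cmod_omega_mult (v : C) : Cmod (omega * v)%C = Cmod v.
Proof.
rewrite Cmod_mult.
replace (Cmod omega) with 1; [ring |].
unfold Cmod, omega; simpl; rewrite !Rmult_1_r, inv_sqrt2_sq.
replace (/ 2 + / 2) with 1 by lra. symmetry; apply sqrt_1.
Qed.

Lemma Cmod_ge_fst (a b : R) : 0 <= a -> a <= Cmod (a, b).
Proof.
intros Ha; apply Rle_trans with (2 := re_le_Cmod _); simpl; apply Rle_abs.
Qed.

(** The choice of r^2 modulo 2 pi: e^{-i r^2} = e^{-3 i pi/4} = - e^{i pi/4},
    which gives e^{-p^2} the argument of -p up to an error tending to 0. *)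
Lemma Cexp_phase (n : nat) (r : R) :
  r * r = 3 * (PI / 4) + 2 * INR n * PI -> Cexp (- (Ci * (RtoC r * RtoC r)))%C = (- omega)%C.
Proof.
intros Hr.
replace (- (Ci * (RtoC r * RtoC r)))%C with ((0, - (r * r)) : C)
  by (unfold Cmult, Copp, Ci; simpl; f_equal; ring).
unfold Cexp; simpl.
rewrite exp_0, cos_neg, sin_neg, Hr, cos_period, sin_period, cos_3PI4, sin_3PI4.
unfold omega, Copp; simpl; f_equal; field; apply Rgt_not_eq, sqrt_lt_R0; lra.
Qed.

(** With these r and s, e^{-p^2} = -2 mu r e^{i pi/4} e^{i s^2}, whereas
    2 mu p = 2 mu r e^{i pi/4} (1 + i s/r).  Their sum is small relative to
    e^{-p^2} as s and s/r are small.  Half of the budget 1/48 goes to this sum,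
    the other half to the error of the asymptotic formula. *)
Lemma approximate_preimage (mu r s : R) (n : nat) :
  0 < mu -> 20 <= r -> 0 <= s <= / 20 ->
  r * r = 3 * (PI / 4) + 2 * INR n * PI ->
  exp (2 * r * s) = 2 * mu * r ->
  let p := (omega * (r, s))%C in
  Cmod (2 * p * (Erfc p - RtoC (- mu)))%C <= / 48 * Cmod (gauss p).
Proof.
intros Hmu Hr Hs Hn He p.
assert (Eg : gauss p = (- (RtoC (2 * mu * r) * omega * Cexp (Ci * RtoC (s * s))))%C).
{ unfold gauss.
  assert (E : (- p ^ 2)%C = (RtoC (2 * r * s) + (- (Ci * (RtoC r * RtoC r)) + Ci * RtoC (s * s)))%C).
  { unfold p.
    replace (- (omega * (r, s)) ^ 2)%C with (- ((omega * omega) * ((r, s) * (r, s))))%C by ring.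
    rewrite omega_sq.
    unfold Cplus, Cmult, Copp, Ci, RtoC; simpl; f_equal; ring. }
  rewrite E, !Cexp_plus, (Cexp_phase n r Hn).
  replace (Cexp (RtoC (2 * r * s))) with (RtoC (2 * mu * r)); [ring |].
  unfold Cexp, RtoC; simpl; rewrite cos_0, sin_0, He; f_equal; ring. }
assert (Hmr : 0 < 2 * mu * r) by (apply Rmult_lt_0_compat; lra).
assert (Hg : Cmod (gauss p) = 2 * mu * r).
{ rewrite Eg, Cmod_opp, Cmod_mult, (Cmult_comm _ omega), Cmod_omega_mult, Cmod_R, Cmod_Cexp.
  rewrite Rabs_pos_eq by lra.
  replace (Re (Ci * RtoC (s * s))%C) with 0 by (simpl; ring).
  rewrite exp_0; ring. }
assert (Hmain : Cmod (gauss p + 2 * RtoC mu * p)%C <= / 96 * Cmod (gauss p)).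
{ set (q := (Ci * RtoC (s * s))%C) in *.
  assert (Hq : Cmod q = s * s)
    by (unfold q; rewrite Cmod_mult, Cmod_Ci, Cmod_R, Rabs_pos_eq by nra; ring).
  assert (HI : Cmod (1 - Cexp q)%C <= 2 * (s * s)) by (rewrite <- Hq; apply Cmod_1_minus_Cexp_le; nra).
  replace (gauss p + 2 * RtoC mu * p)%C
    with (omega * (RtoC (2 * mu * r) * (1 - Cexp q) + RtoC (2 * mu * s) * Ci))%C.
  2: { rewrite Eg; unfold p.
       replace ((r, s) : C) with (RtoC r + RtoC s * Ci)%C
         by (unfold Cplus, Cmult; simpl; f_equal; ring).
       rewrite !RtoC_mult; ring. }
  rewrite Cmod_omega_mult, Hg.
  apply Rle_trans with (1 := Cmod_triangle _ _).
  rewrite !Cmod_mult, Cmod_Ci, !Cmod_R, !Rabs_pos_eq by nra.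
  assert (2 * mu * r * Cmod (1 - Cexp q)%C <= 2 * mu * r * (/ 200)).
  { apply Rmult_le_compat_l; nra. }
  assert (2 * mu * s <= 2 * mu * r * / 400) by nra.
  nra. }
set (x := / sqrt 2 * (r - s)); set (y := / sqrt 2 * (r + s)).
assert (Ep : p = (x, y)) by (unfold p, x, y, omega, Cmult; simpl; f_equal; ring).
assert (Hh : 0 < / sqrt 2) by (apply Rinv_0_lt_compat, sqrt_lt_R0; lra).
assert (Hx : 0 < x) by (apply Rmult_lt_0_compat; lra).
assert (Hy : 0 <= y) by (apply Rmult_le_pos; lra).
assert (Hx2 : 48 <= x ^ 2).
{ replace (x ^ 2) with (/ 2 * ((r - s) * (r - s))) by (rewrite <- inv_sqrt2_sq; unfold x; ring).
  nra. }
pose proof (Erfc_asymptotic x y Hx Hy) as HA.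
rewrite <- Ep in HA.
assert (Cmod (gauss p) / (2 * x ^ 2) <= / 96 * Cmod (gauss p)).
{ unfold Rdiv; rewrite Rmult_comm; apply Rmult_le_compat_r; [apply Cmod_ge_0 |].
  apply Rinv_le_contravar; lra. }
replace (2 * p * (Erfc p - RtoC (- mu)))%C
  with ((2 * p * Erfc p - gauss p) + (gauss p + 2 * RtoC mu * p))%C by (rewrite RtoC_opp; ring).
apply Rle_trans with (1 := Cmod_triangle _ _). lra.
Qed.

(** Makes s = ln(2 mu r) / (2r) at most 1/20, by the bound
    e^{r/10} >= (r/20)^2. *)
Lemma ln_le_tenth (mu r : R) :
  0 < mu -> 0 < r -> 800 * mu <= r -> ln (2 * mu * r) <= r / 10.
Proof.
intros Hmu Hr0 Hr.
rewrite <- (ln_exp (r / 10)).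
apply ln_le; [apply Rmult_lt_0_compat; lra |].
replace (r / 10) with (r / 20 + r / 20) by lra.
rewrite exp_plus.
pose proof (exp_ineq1_le (r / 20)).
apply Rle_trans with ((r / 20) * (r / 20)); [nra |].
apply Rmult_le_compat; lra.
Qed.

(** * Solutions of Erfc(w) = -mu and the singularities *)

(** The exact solution differs from the approximate one by at most 1 / (48 r)
    in each rotated coordinate.  The requirement ln(2 mu r) >= 1, which gives
    s >= 1 / (2r), keeps b positive; b stays bounded while a grows, hence
    b <= eta a. *)
Lemma Erfc_negative_preimage (mu eta A : R) :
  0 < mu -> 0 < eta ->
  exists a b, A <= a /\ 0 < a /\ 0 < b <= eta * a /\ Erfc (omega * (a, b))%C = RtoC (- mu).
Proof.
intros Hmu Heta.
(* The terms secure, in this order: r >= 20, A <= a, b <= eta a,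
   ln(2 mu r) <= r / 10, and ln(2 mu r) >= 1. *)
set (B := Rmax (Rmax 20 (A + 1)) (Rmax (2 / eta + 1) (Rmax (800 * mu) (3 / (2 * mu))))).
destruct (INR_unbounded (B * B)) as [n Hn].
set (r := sqrt (3 * (PI / 4) + 2 * INR n * PI)).
pose proof PI2_1 as HPI; pose proof (pos_INR n) as Hn0.
assert (Hrr : r * r = 3 * (PI / 4) + 2 * INR n * PI) by (apply sqrt_sqrt; nra).
assert (HB : B <= r).
{ destruct (Rle_or_lt B r) as [h|h]; trivial; exfalso.
  assert (0 <= r) by apply sqrt_pos.
  assert (r * r <= B * B) by (apply Rmult_le_compat; lra). nra. }
assert (H1 : 20 <= r /\ A + 1 <= r /\ 2 / eta + 1 <= r /\ 800 * mu <= r /\ 3 / (2 * mu) <= r).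
{ assert (Hmax : forall u v, Rmax u v <= r -> u <= r /\ v <= r).
  { intros u v h; split; apply Rle_trans with (2 := h); [apply Rmax_l | apply Rmax_r]. }
  destruct (Hmax _ _ HB) as [h1 h2].
  destruct (Hmax _ _ h1), (Hmax _ _ h2) as [h3 h4].
  destruct (Hmax _ _ h4); auto. }
destruct H1 as [H1 [H2 [H3 [H4 H5]]]].
assert (H6 : 3 <= 2 * mu * r).
{ replace 3 with (2 * mu * (3 / (2 * mu))) by (field; lra).
  apply Rmult_le_compat_l; lra. }
set (L := ln (2 * mu * r)).
assert (HL1 : 1 <= L).
{ unfold L; rewrite <- (ln_exp 1); apply ln_le; [apply exp_pos |].
  pose proof exp_le_3; lra. }
pose proof (ln_le_tenth mu r Hmu ltac:(lra) H4) as HL2; fold L in HL2.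
set (s := L / (2 * r)).
assert (Hs : s * (2 * r) = L) by (unfold s; field; lra).
assert (Hs0 : 0 < s) by nra.
assert (Hs1 : s <= / 20) by nra.
set (p := (omega * (r, s))%C).
assert (Hp : r <= Cmod p) by (unfold p; rewrite Cmod_omega_mult; apply Cmod_ge_fst; lra).
destruct (Erfc_preimage_near p (RtoC (- mu))) as [w [Hw1 Hw2]].
{ lra. }
{ apply (approximate_preimage mu r s n); trivial; [lra |].
  replace (2 * r * s) with L by lra. apply exp_ln; lra. }
(* v is w in rotated coordinates, since - i e^{i pi/4} = e^{-i pi/4}. *)
set (v := (- Ci * omega * w)%C).
assert (Hv : w = (omega * v)%C).
{ unfold v; replace (omega * (- Ci * omega * w))%C with (- Ci * (omega * omega) * w)%C by ring.
  rewrite omega_sq. destruct w as [w1 w2]; unfold Cmult, Copp, Ci; simpl; f_equal; ring. }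
clearbody v; subst w; destruct v as [a b].
assert (Hd : Cmod (a - r, b - s) <= / (48 * r)).
{ rewrite <- Cmod_omega_mult.
  replace (omega * ((a - r)%R, (b - s)%R))%C with (omega * (a, b) - p)%C
    by (unfold p, Cminus, Cplus, Copp, Cmult; simpl; f_equal; ring).
  apply Rle_trans with (1 := Hw1).
  apply Rinv_le_contravar; nra. }
pose proof (Rmax_Cmod (a - r, b - s)) as Hmax; simpl in Hmax.
pose proof (Rmax_l (Rabs (a - r)) (Rabs (b - s))).
pose proof (Rmax_r (Rabs (a - r)) (Rabs (b - s))).
assert (Ha : Rabs (a - r) <= / (48 * r)) by lra.
assert (Hb : Rabs (b - s) <= / (48 * r)) by lra.
apply Rabs_le_between in Ha; apply Rabs_le_between in Hb.
set (i := / (48 * r)) in *.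
assert (Hi : i * (48 * r) = 1) by (unfold i; field; lra).
assert (Hi0 : 0 < i) by (apply Rinv_0_lt_compat; lra).
assert (Hi1 : i <= 1) by nra.
assert (Hsi : i < s) by nra.
exists a, b; repeat split; trivial; try lra.
apply Rle_trans with 2; [lra |].
replace 2 with (eta * (2 / eta)) by (field; lra).
apply Rmult_le_compat_l; lra.
Qed.

Lemma atan_le_id (x : R) : 0 <= x -> atan x <= x.
Proof.
intros Hx.
destruct (MVT_cor4 atan (fun c => / (1 + c²)) 0 x) with (b := x) as [c [Hc _]].
{ intros c _; apply is_derive_atan. }
{ rewrite Rminus_0_r, Rabs_pos_eq; lra. }
rewrite atan_0, !Rminus_0_r in Hc; rewrite Hc.
assert (/ (1 + c²) <= 1).
{ rewrite <- Rinv_1 at 2. apply Rinv_le_contravar; [lra |].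
  pose proof (Rle_0_sqr c); lra. }
nra.
Qed.

(** Multiplication by e^{i pi/4} turns the argument atan(b/a) into
    pi/4 + atan(b/a), and 0 < atan(b/a) <= b/a. *)
Lemma sector_omega (a b eps : R) :
  0 < a -> 0 < b -> b / a < eps -> sector (PI / 4) (PI / 4 + eps) (omega * (a, b))%C.
Proof.
intros Ha Hb Heps.
set (t := b / a) in *.
assert (Ht : 0 < t) by (apply Rdiv_lt_0_compat; lra).
assert (Hbt : b = a * t) by (unfold t; field; lra).
assert (Hat : 0 < atan t) by (rewrite <- atan_0; apply atan_increasing; lra).
pose proof (atan_le_id t ltac:(lra)).
pose proof (atan_bound t).
assert (Hq : 0 < sqrt (1 + t²)) by (apply sqrt_lt_R0; pose proof (Rle_0_sqr t); lra).
assert (Hm : Cmod (omega * (a, b))%C = a * sqrt (1 + t²)).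
{ rewrite Cmod_omega_mult; unfold Cmod; simpl.
  replace (a * (a * 1) + b * (b * 1)) with ((a * a) * (1 + t²)) by (rewrite Hbt; unfold Rsqr; ring).
  rewrite sqrt_mult, sqrt_square; trivial; try nra. pose proof (Rle_0_sqr t); lra. }
exists (PI / 4 + atan t); split; [| lra].
split; [| split; [lra |]].
- apply Cmod_gt_0; rewrite Hm; apply Rmult_lt_0_compat; trivial.
- rewrite Hm, cos_plus, sin_plus, cos_PI4, sin_PI4, cos_atan, sin_atan.
  unfold omega, Cmult; simpl; rewrite Hbt.
  assert (0 < sqrt 2) by (apply sqrt_lt_R0; lra).
  f_equal; field; lra.
Qed.

Lemma u_singularity_far (k : nat) (lam eps A : R) :
  (2 <= k)%nat -> 0 < lam -> 0 < eps ->
  exists z, u_singularity k lam z /\ sector (PI / 4) (PI / 4 + eps) z /\ A <= Cmod z.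
Proof.
intros Hk Hlam Heps.
assert (HK : 2 <= INR k) by (apply (le_INR 2); trivial).
set (alpha := sqrt ((INR k - 1) / 2)).
set (beta := sqrt (2 * INR k - 2)).
assert (Halpha : 0 < alpha) by (apply sqrt_lt_R0; lra).
assert (Hbeta : 0 < beta) by (apply sqrt_lt_R0; lra).
destruct (Erfc_negative_preimage (lam / beta) (eps / 2) (alpha * A)) as [a [b [H1 [H2 [H3 H4]]]]].
{ apply Rdiv_lt_0_compat; lra. }
{ lra. }
assert (Hz : (RtoC alpha * (omega * ((a / alpha)%R, (b / alpha)%R)) = omega * (a, b))%C).
{ pose proof sqrt2_neq_0; unfold Cmult, RtoC; simpl; f_equal; field; lra. }
exists (omega * ((a / alpha)%R, (b / alpha)%R))%C; split; [| split].
- unfold u_singularity, u_bracket; fold alpha; fold beta.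
  rewrite Hz, H4, <- RtoC_mult, <- RtoC_plus.
  f_equal; field; lra.
- apply sector_omega; try (apply Rdiv_lt_0_compat; lra).
  replace (b / alpha / (a / alpha)) with (b / a) by (field; lra).
  apply Rmult_lt_reg_r with a; trivial.
  replace (b / a * a) with b by (field; lra). nra.
- rewrite Cmod_omega_mult.
  apply Rle_trans with (a / alpha).
  + apply Rmult_le_reg_l with alpha; trivial.
    replace (alpha * (a / alpha)) with a by (field; lra). lra.
  + apply Cmod_ge_fst; left; apply Rdiv_lt_0_compat; trivial.
Qed.

Theorem proposition5p1 :
  forall k : nat, (2 <= k)%nat ->
  exists lam0 : R, forall lam : R, 0 < lam -> lam <> lam0 ->
  forall eps : R, 0 < eps ->
    (exists z : nat -> C,
       (forall n, u_singularity k lam (z n)) /\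
       (forall n, sector (PI / 4) (PI / 4 + eps) (z n)) /\
       tends_to_infinity z) \/
    (exists z : nat -> C,
       (forall n, u_singularity k lam (z n)) /\
       (forall n, sector (3 * PI / 4 - eps) (3 * PI / 4) (z n)) /\
       tends_to_infinity z).
Proof.
intros k Hk; exists 0; intros lam Hlam _ eps Heps; left.
destruct (functional_choice _ (fun n => u_singularity_far k lam eps (INR n) Hk Hlam Heps)) as [z Hz].
exists z; split; [| split]; try (intros n; apply Hz).
apply is_lim_seq_le_p_loc with (2 := is_lim_seq_INR).
exists 0%nat; intros n _; apply Hz.
Qed.
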